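(* For every $n \ge 2$ and every $S \subseteq [n-2]$, the number $\beta_{\Pi_n}(S)$ is equal to the number of elements $\sigma$ (counted with multiplicity) of the multiset $\mathcal{A}_n$ with descent set $\mathrm{Des}(\sigma)$ equal to $n-1-S := \{n-1-x : x \in S\}$. In particular, $$h_{\Pi_n}(x) \ = \ \sum_{\sigma \in \mathcal{A}_n} x^{\mathrm{des}(\sigma)}$$ for every $n \ge 2$.
   Context: Write $[m]=\{1,\dots,m\}$ (with $[0]=\varnothing$). $\Pi_n$ is the set of all set partitions of $[n]$, ordered by $\pi \preceq \sigma$ if every block of $\pi$ is contained in a block of $\sigma$; it is a graded lattice of rank $n-1$ with minimum the partition into singletons. For a finite graded poset $\mathcal{L}$ of rank $r$ with minimum $\hat 0$, maximum $\hat 1$ and rank function $\rho$, and for $S \subseteq [r-1]$, let $\alpha_{\mathcal{L}}(S)$ be the number of maximal chains of the subposet $\{t \in \mathcal{L} : \rho(t) \in S\} \cup \{\hat 0,\hat 1\}$, and let $\beta_{\mathcal{L}}(S) = \sum_{T \subseteq S} (-1)^{|S \setminus T|} \alpha_{\mathcal{L}}(T)$. For a finite poset $\mathcal{L}$, $h_{\mathcal{L}}(x) = (1-x)^N p_{\mathcal{L}}\left(\frac{x}{1-x}\right)$, where $p_{\mathcal{L}}(x) = \sum_{k\ge 0} c_k(\mathcal{L}) x^k$, $c_k(\mathcal{L})$ is the number of $k$-element chains of $\mathcal{L}$, and $N$ is the largest cardinality of a chain in $\mathcal{L}$. $\mathcal{A}_n$ is the multiset $M_1 \times M_2 \times \cdots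 \times M_{n-1}$ of words $\sigma = (\sigma_1,\dots,\sigma_{n-1})$, where $M_k$ is the multiset in which each $i \in [k]$ appears exactly $k+1-i$ times (so $M_1=\{1\}$, $M_2=\{1,1,2\}$, $M_3=\{1,1,1,2,2,3\}$, etc.); multiplicities multiply in the product, and sums over $\mathcal{A}_n$ are with multiplicity. For $\sigma \in \mathcal{A}_n$, $\mathrm{Des}(\sigma) = \{i \in [n-2] : \sigma_i \ge \sigma_{i+1}\}$ and $\mathrm{des}(\sigma) = |\mathrm{Des}(\sigma)|$. *)

(* Defs.v *)
From HB Require Import structures.
From mathcomp Require Import all_boot all_order all_algebra.
From mathcomp Require Import finmap.

Set Implicit Arguments.
Unset Strict Implicit.
Unset Printing Implicit Defensive.

Import Order.TTheory GRing.Theory Num.Theory.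

Local Open Scope ring_scope.

Section FinitePosets.
Context {d : Order.disp_t}.

Definition is_chain (L : finPOrderType d) (C : {set L}) : bool :=
  [forall x in C, forall y in C, (x >=< y)%O].

(* The length of a longest chain with top element t. If L is graded and has a *)
(* minimum, all maximal chains of [\bot, t] have this length, and it is the   *)
(* rank function of L.                                                        *)
Definition rk (L : finPOrderType d) (t : L) : nat :=
  (\max_(C : {set L} | is_chain C && [forall x in C, (x <= t)%O]) #|C|).-1.

Definition rank_selection (L : finTBPOrderType d) (S : {fset nat}) : {set L} :=
  [set t : L | rk t \in S] :|: [set \bot%O; \top%O].

Definition alpha (L : finTBPOrderType d) (S : {fset nat}) : nat :=
  #|[set C : {set L} |
      maxset [pred D : {set L} | is_chain D && (D \subset rank_selection L S)] C]|.

Definition beta (L : finTBPOrderType d) (S : {fset nat}) : int :=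
  \sum_(T <- fpowerset S) (-1) ^+ #|` (S `\` T)%fset| * (alpha L T)%:Z.

Definition nb_chains (L : finPOrderType d) (k : nat) : nat :=
  #|[set C : {set L} | is_chain C & #|C| == k]|.

(* nb_chains L k vanishes for k > #|L|, so the sum over k is finite. *)
Definition chain_poly (L : finPOrderType d) : {poly rat} :=
  \poly_(k < #|L|.+1) (nb_chains L k)%:R.

Definition max_chain_size (L : finPOrderType d) : nat :=
  \max_(C : {set L} | is_chain C) #|C|.

End FinitePosets.

(* The field Q(x) of rational functions. *)
Definition Qx : fieldType := {fraction {poly rat}}.
Definition varx : Qx := tofrac 'X.

Definition h_frac {d : Order.disp_t} (L : finPOrderType d) : Qx :=
  (1 - varx) ^+ max_chain_size L *
  (map_poly (fun c : rat => tofrac c%:P : Qx) (chain_poly L)).[varx / (1 - varx)].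

(* Set partitions of a set with n elements; 'I_n = {0, ..., n-1} stands for   *)
(* {1, ..., n}. Blocks are nonempty by the definition of partition.           *)
Record setpart (n : nat) := SetPart {
  blocks :> {set {set 'I_n}};
  blocksP : partition blocks [set: 'I_n] }.

HB.instance Definition _ n := [isSub for @blocks n].
HB.instance Definition _ n := [Finite of setpart n by <:].

Fact setpart_display : Order.disp_t.
Proof. exact: (Order.Disp tt tt). Qed.

Section SetPartitionOrder.
Variable n : nat.
Implicit Types P Q : setpart n.

Definition refines P Q : bool :=
  [forall B in blocks P, exists D in blocks Q, B \subset D].

Lemma refinesP P Q :
  reflect (forall B, B \in blocks P -> exists2 D, D \in blocks Q & B \subset D)
          (refines P Q).
Proof.
apply: (iffP forall_inP) => H B /H; first by case/exists_inP=> D; exists D.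
by case=> D ? ?; apply/exists_inP; exists D.
Qed.

Lemma refines_refl : reflexive refines.
Proof. by move=> P; apply/refinesP=> B; exists B. Qed.

Lemma refines_trans : transitive refines.
Proof.
move=> Q P U /refinesP PQ /refinesP QU; apply/refinesP=> B /PQ[D /QU[E EU DE] BD].
by exists E => //; apply: subset_trans DE.
Qed.

Lemma refines_blocks_sub P Q :
  refines P Q -> refines Q P -> blocks P \subset blocks Q.
Proof.
move=> /refinesP PQ /refinesP QP; apply/subsetP=> B BP.
have [D DQ BD] := PQ B BP; have [B' B'P DB'] := QP D DQ.
have /and3P[_ /trivIsetP tiP P0] := blocksP P.
have eqBB' : B = B'.
  apply/eqP; apply: contraT => /(tiP _ _ BP B'P) dBB'.
  have B0 : B = set0.
    by apply/eqP; rewrite -subset0 -(disjoint_setI0 dBB') subsetI subxx (subset_trans BD).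
  by move: P0; rewrite -B0 BP.
suff -> : B = D by [].
by apply/eqP; rewrite eqEsubset BD eqBB'.
Qed.

Lemma refines_anti : antisymmetric refines.
Proof.
move=> P Q /andP[PQ QP]; apply: val_inj; apply/eqP.
by rewrite /= eqEsubset !refines_blocks_sub.
Qed.

HB.instance Definition _ :=
  Order.Le_isPOrder.Build setpart_display (setpart n)
    refines_refl refines_anti refines_trans.

Lemma singletons_partition :
  partition [set [set i] | i : 'I_n] [set: 'I_n].
Proof.
apply/and3P; split.
- apply/eqP/setP=> i; rewrite inE; apply/bigcupP.
  by exists [set i]; rewrite ?set11 ?imset_f.
- apply/trivIsetP=> _ _ /imsetP[i _ ->] /imsetP[j _ ->] nij.
  by rewrite disjoints1 inE; apply: contraNneq nij => ->.
- by apply/imsetP=> -[i _ /setP/(_ i)]; rewrite !inE eqxx.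
Qed.

Definition singletons : setpart n := SetPart singletons_partition.

Lemma refines_singletons P : (singletons <= P)%O.
Proof.
apply/refinesP=> _ /imsetP[i _ ->].
have /and3P[/eqP covP _ _] := blocksP P.
have iP : i \in cover P by rewrite covP.
by exists (pblock P i); rewrite ?pblock_mem // sub1set mem_pblock.
Qed.

(* For n > 0 the only block is the whole set; for n = 0 there is no block. *)
Lemma one_block_partition : partition ([set [set: 'I_n]] :\ set0) [set: 'I_n].
Proof.
apply/and3P; split; last by rewrite !inE eqxx.
- apply/eqP/setP=> i; rewrite inE; apply/bigcupP; exists [set: 'I_n] => //.
  by rewrite !inE eqxx andbT; apply/set0Pn; exists i.
- apply/trivIsetP=> A B; rewrite !inE.
  by case/andP=> _ /eqP-> /andP[_ /eqP->]; rewrite eqxx.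
Qed.

Definition one_block : setpart n := SetPart one_block_partition.

Lemma refines_one_block P : (P <= one_block)%O.
Proof.
apply/refinesP=> B BP; exists [set: 'I_n]; last exact: subsetT.
have /and3P[_ _ P0] := blocksP P.
have /set0Pn[i _] : B != set0 by apply: contraNneq P0 => <-.
by rewrite !inE eqxx andbT; apply/set0Pn; exists i.
Qed.

HB.instance Definition _ :=
  Order.hasBottom.Build setpart_display (setpart n) refines_singletons.
HB.instance Definition _ :=
  Order.hasTop.Build setpart_display (setpart n) refines_one_block.

End SetPartitionOrder.

(* Multisets are represented by sequences with repetitions, so that count and *)
(* \sum_(_ <- _) take multiplicities into account.                            *)
Definition M (k : nat) : seq nat :=
  flatten [seq nseq (k + 1 - i) i | i <- iota 1 k].

Definition words (Ms : seq (seq nat)) : seq (seq nat) :=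
  foldr (fun X W => [seq x :: w | x <- X, w <- W]) [:: [::]] Ms.

Definition A (n : nat) : seq (seq nat) := words [seq M k | k <- iota 1 n.-1].

(* Letters are numbered from 1, so the letter s_i is nth 0 s i.-1. A word of  *)
(* A n has size n - 1, so i ranges over 1, ..., n - 2.                        *)
Definition Des (s : seq nat) : {fset nat} :=
  [fset i in iota 1 (size s).-1 | nth 0 s i.-1 >= nth 0 s i]%N%fset.

Definition des (s : seq nat) : nat := #|` Des s|.

(* Main.v *)
(* Let alpha(T) count the chains of Pi_n with rank set T. A partition with b   *)
(* blocks has S(b,c) coarsenings with c blocks (Stirling numbers of the second *)
(* kind), so for T = {t_1 < ... < t_k},                                       *)
(*   alpha(T) = S(n, n-t_1) S(n-t_1, n-t_2) ... S(n-t_k, 1).                  *)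
(* A word with Des contained in n-1-T is a concatenation of strictly increasing *)
(* runs; a run occupying the positions a, ..., b is counted by the weakly     *)
(* decreasing sequences of multiplicities m_a >= ... >= m_b with m_a <= a,    *)
(* weighted by their product, i.e. by the complete homogeneous polynomial     *)
(* h_(b-a+1)(1, ..., a) = S(b+1, a). Hence alpha(T) is also the number of     *)
(* words with Des contained in n-1-T, and both claims follow by               *)
(* inclusion-exclusion, as h(x) is the sum over T of                          *)
(* alpha(T) x^|T| (1-x)^(n-2-|T|).                                            *)
Require Import Defs.
From HB Require Import structures.
From mathcomp Require Import all_boot all_order all_algebra zify ring.
From mathcomp Require Import finmap.

Set Implicit Arguments.
Unset Strict Implicit.
Unset Printing Implicit Defensive.

Import Order.TTheory GRing.Theory Num.Theory.

Local Open Scope ring_scope.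

(** * Words *)

Section Words.
Local Open Scope nat_scope.

(** Chains and words are compared through cumulative counts: [alpha] on one side, and on the other
    the number of words whose reflected descent set [coDes] lies in S. Both obey one recursion on
    the rank t. A flag of set partitions reaching rank t is extended to rank t+1 by coarsening its
    top element, and the number of ways is a Stirling number depending only on the rank of that
    element ([card_coarsenings], [card_upper], [card_flagsS]). A word is built from the right. Along
    a strictly increasing run the multiplicities weakly decrease, so a run contributes a complete
    homogeneous polynomial in 1, ..., m, which is again a Stirling number ([stirling2_sum],
    [nb_ok_flags]). Ranks correspond to lengths of suffixes, whence the reflection of i into n-1-i.
    [alpha_setpart] joins the two counts.

    The formula for [beta] follows by Moebius inversion on subsets ([fpowerset_moebius]). For the
    h-polynomial, chains are reduced to those through both extrema and sorted by rank set
    ([chain_sumE]). Substituting x/(1-x) gives the sum over J of alpha(J) x^|J| (1-x)^(n-2-|J|), in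
    which each word contributes x^des by [superset_sum]. *)

Fixpoint stirling2 (n k : nat) : nat :=
  match n, k with
  | 0, 0 => 1
  | n'.+1, k'.+1 => stirling2 n' k' + k * stirling2 n' k
  | _, _ => 0
  end.

Lemma stirling2S n k :
  stirling2 n.+1 k.+1 = stirling2 n k + k.+1 * stirling2 n k.+1.
Proof. by []. Qed.

Lemma stirling2_small n k : n < k -> stirling2 n k = 0.
Proof.
elim: n k => [|n IH] [|k] //= /ltnSE lt_nk.
by rewrite !IH ?muln0 // ltnW // ltnS.
Qed.

Lemma stirling2nn n : stirling2 n n = 1.
Proof. by elim: n => //= n ->; rewrite stirling2_small ?muln0 ?addn0. Qed.

Lemma stirling2n1 n : stirling2 n.+1 1 = 1.
Proof. by elim: n => //= n ->. Qed.

(** As S(m+d, m) is the complete homogeneous polynomial h_d(1, ..., m), this is its expansion by the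
    largest variable j occurring in a monomial. *)
Lemma stirling2_sum d m :
  stirling2 (m + d).+1 m = \sum_(1 <= j < m.+1) j * stirling2 (j + d) j.
Proof.
elim: m => [|m IH]; first by rewrite big_geq.
by rewrite big_nat_recr // -IH addSn stirling2S.
Qed.

(* [ok T s] says that the word s has no descent at a position i (counted from *)
(* 1) with [size s - i] outside T.                                            *)
Fixpoint ok (T : pred nat) (s : seq nat) : bool :=
  if s is x :: w then
    [|| w == [::], T (size w) | x < head 0 w] && ok T w
  else true.

Lemma okP T s :
  ok T s = all (fun i => T (size s - i) || (nth 0 s i.-1 < nth 0 s i))
               (iota 1 (size s).-1).
Proof.
elim: s => [|x [|y w] IH] //.
rewrite [LHS]/= -/(ok T (y :: w)) IH /= subSS subn0; congr andb.
rewrite (iotaDl 1 1) all_map; apply: eq_in_all => i.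
by rewrite mem_iota /=; case: i.
Qed.

Definition tail_words k t := words [seq M i | i <- iota k t].

Lemma tail_wordsS k t :
  tail_words k t.+1 = [seq x :: w | x <- M k, w <- tail_words k.+1 t].
Proof. by []. Qed.

Lemma size_tail_words k t s : s \in tail_words k t -> size s = t.
Proof.
elim: t k s => [|t IH] k s; first by rewrite inE => /eqP->.
by rewrite tail_wordsS => /allpairsP[[x w] /= [_ /IH <- ->]].
Qed.

(* Letters are indexed by their multiplicity [j = k + 1 - x] in [M k].          *)
Lemma sum_M k (F : nat -> nat) :
  \sum_(x <- M k) F x = \sum_(1 <= j < k.+1) j * F (k.+1 - j).
Proof.
rewrite /M big_flatten /= big_map.
rewrite big_nat_rev /= /index_iota subn1 /= !big_seq.
apply: eq_bigr => i; rewrite mem_iota => hi.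
rewrite big_nseq iter_addn_0 mulnC; congr (_ * F _); lia.
Qed.

(* In terms of multiplicities [k + 1 - x] (x the letter at position k), a strict *)
(* ascent says that the multiplicity does not increase; [nb_ok T k t m] counts *)
(* the suffixes starting at position k whose first multiplicity is at most m. *)
Definition nb_ok T k t m :=
  count (fun s => ok T s && (k < head 0 s + m)) (tail_words k t).

Lemma nb_okS T k t m : m <= k -> 0 < t ->
  nb_ok T k t.+1 m = \sum_(1 <= j < m.+1)
    j * (if T t then nb_ok T k.+1 t k.+1 else nb_ok T k.+1 t j).
Proof.
move=> le_mk t0; rewrite /nb_ok tail_wordsS -sum1_count big_mkcond big_allpairs_dep.
rewrite /= (eq_bigr (fun x => (k < x + m) * count (fun w => ok T (x :: w))
   (tail_words k.+1 t))); last first.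
  move=> x _; rewrite -sum1_count [in RHS]big_mkcond /= big_distrr /=.
  by apply: eq_bigr => w _; case: (k < _); rewrite ?andbT ?andbF ?mul1n.
(* The condition [k < x + m] kills the multiplicities j > m. *)
rewrite sum_M (big_cat_nat _ (n := m.+1)) //= [X in _ + X]big1_seq ?addn0; last first.
  by move=> j /andP[_]; rewrite mem_index_iota => hj;
     rewrite (_ : k < _ = false) ?muln0 //; lia.
rewrite !big_seq; apply: eq_bigr => j; rewrite mem_index_iota => hj.
rewrite (_ : k < _ = true) ?mul1n; last by lia.
congr (_ * _); case: ifP => Tt; apply: eq_in_count => w hw /=.
(* A descent is allowed here, and the bound [k.+1] at position [k.+1] excludes nothing because
   letters are positive. *)
- have sw := size_tail_words hw; rewrite sw Tt orbT /= (_ : k.+1 < _ = true) ?andbT //.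
  move: t0 hw; case: (t) => // t' _; rewrite tail_wordsS.
  case/allpairsP=> -[x w'] /= [xM _ ->] /=.
  move: xM; rewrite /M => /flattenP[s /mapP[i]]; rewrite mem_iota => hi ->.
  by rewrite mem_nseq => /andP[_ /eqP->]; lia.
- have sw := size_tail_words hw; rewrite sw Tt (_ : w == [::] = false) /= 1?andbC.
    congr andb; lia.
  by apply/eqP => w0; move: t0; rewrite -sw w0.
Qed.


(** The default 0 stands for the rank of the bottom element, which every flag contains. *)
Fixpoint last_below (T : pred nat) (t : nat) : nat :=
  if t is t'.+1 then if T t then t else last_below T t' else 0.

Lemma last_below_le T t : last_below T t <= t.
Proof. by elim: t => //= t IH; case: ifP => // _; apply: leqW. Qed.

Lemma nb_ok1 T k m : m <= k -> nb_ok T k 1 m = stirling2 m.+1 m.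
Proof.
move=> le_mk; have := stirling2_sum 0 m; rewrite addn0 => ->.
rewrite (eq_bigr id) => [|j _]; last by rewrite addn0 stirling2nn muln1.
rewrite /nb_ok tail_wordsS -sum1_count big_mkcond big_allpairs_dep /=.
rewrite (eq_bigr (fun x => (k < x + m) : nat)) => [|x _]; last first.
  by rewrite big_seq1 /=; case: (k < _).
rewrite sum_M (big_cat_nat _ (n := m.+1)) //= [X in _ + X]big1_seq ?addn0; last first.
  by move=> j /andP[_]; rewrite mem_index_iota => hj;
     rewrite (_ : k < _ = false) ?muln0 //; lia.
rewrite !big_seq; apply: eq_bigr => j; rewrite mem_index_iota => hj.
by rewrite (_ : k < _ = true) ?muln1 //; lia.
Qed.

(** * Words counted by the recursion for flags *)

Section FlagRecursion.
(** [D t] plays the number of flags with ranks in T up to t; [alpha_setpart] instantiates it so. *)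
Variables (n : nat) (T : pred nat) (D : nat -> nat).
Hypothesis D0 : D 0 = 1.
Hypothesis DS : forall t, t.+1 < n ->
  D t.+1 = if T t.+1 then D t * stirling2 (n - last_below T t) (n - t.+1) else D t.

(** The first possible descent comes when [last_below T t] letters remain. The run before it has
    multiplicities weakly decreasing from at most m, which gives the Stirling factor; [D t] accounts
    for the rest. *)
Lemma nb_ok_flags t k m : t.+1 + k = n -> m <= k ->
  nb_ok T k t.+1 m = D t * stirling2 (m + (t.+1 - last_below T t)) m.
Proof.
elim: t k m => [|t IH] k m def_n le_mk.
  by rewrite nb_ok1 // D0 mul1n addn1.
rewrite nb_okS // DS; last by lia.
have le_l := last_below_le T t.
rewrite /=; case: ifP => Tt.
(* The first run has length one. Since k+1 = n-(t+1), the Stirling factor of the remaining suffix is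
   the new factor of [D t.+1]. *)
- rewrite subSnn addnS stirling2_sum IH //; last by lia.
  rewrite mulnAC (_ : k.+1 = n - t.+1) 1?(_ : _ + (_ - _) = n - last_below T t); try lia.
  rewrite -big_distrl [RHS]mulnAC [RHS]mulnC /=; congr (_ * _).
  by apply: eq_bigr => j _; rewrite addn0 stirling2nn muln1.
- rewrite subSn 1?addnS; last by lia.
  rewrite stirling2_sum big_distrr /= !big_seq; apply: eq_bigr => j.
  rewrite mem_index_iota => hj; rewrite IH; [|lia|lia].
  by rewrite mulnCA.
Qed.

Lemma count_ok_flags : 2 <= n -> count (ok T) (A n) = D n.-2.
Proof.
move=> n2; have -> : A n = tail_words 1 n.-2.+1.
  by rewrite /A /tail_words; congr (words (map _ (iota _ _))); lia.
(* The only letter at position 1 is 1, so the bound m = 1 is vacuous, and the Stirling factor S(.,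
   1) is 1. *)
have := @nb_ok_flags n.-2 1 1; rewrite add1n subSn ?last_below_le // stirling2n1 muln1.
move=> <- //; last by lia.
apply: eq_in_count => _ /= /allpairsP[[x w] /= [xM _ ->]].
by move: xM; rewrite /M /= inE => /eqP->; rewrite andbT.
Qed.

End FlagRecursion.

End Words.

(** * Coarsenings of a set partition *)

Section Coarsenings.
Local Open Scope nat_scope.
Variable T : finType.
Implicit Types (X A B D E : {set T}) (P Q : {set {set T}}).

Definition merge Q E B : {set {set T}} := (E :|: B) |: (Q :\ E).

Lemma partition_merge Q X E B :
  partition Q X -> E \in Q -> [disjoint B & X] -> partition (merge Q E B) (X :|: B).
Proof.
move=> partQ EQ dBX; have sEX := partitionS partQ EQ.
have -> : X :|: B = (E :|: B) :|: (X :\: E).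
  apply/setP=> x; rewrite !inE; have := subsetP sEX x.
  by case: (x \in E); case: (x \in X); case: (x \in B) => // /(_ isT).
apply: partitionU1; first exact: partitionD1.
  have /set0Pn[x xE] := partition_neq0 partQ EQ.
  by apply/set0Pn; exists x; rewrite inE xE.
rewrite -setI_eq0; apply/eqP/setP=> x; rewrite !inE.
case: (x \in E) => //=; case: (boolP (x \in B)) => //= xB.
by rewrite (disjointFr dBX xB).
Qed.

Lemma card_merge Q X E B :
  partition Q X -> E \in Q -> [disjoint B & X] -> #|merge Q E B| = #|Q|.
Proof.
move=> partQ EQ dBX; rewrite cardsU1 (cardsD1 E Q) EQ; congr (nat_of_bool _ + _).
apply/negP=> /setD1P[neq EBQ].
have /trivIsetP/(_ _ _ EBQ EQ neq) := partition_trivIset partQ.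
have /set0Pn[x xE] := partition_neq0 partQ EQ.
by move/disjointFl=> /(_ x xE); rewrite inE xE.
Qed.

Definition coarser P Q := [forall B in P, exists D in Q, B \subset D].

Lemma coarserP P Q :
  reflect (forall B, B \in P -> exists2 D, D \in Q & B \subset D) (coarser P Q).
Proof.
apply: (iffP forall_inP) => H B /H; first by case/exists_inP=> D; exists D.
by case=> D ? ?; apply/exists_inP; exists D.
Qed.

(** The ground set is [cover P], not the whole type, so that induction can remove a block of P. *)
Definition coarsenings P c : {set {set {set T}}} :=
  [set Q | [&& partition Q (cover P), coarser P Q & #|Q| == c]].

(** * The Stirling recurrence, by removing a block *)

Section RemoveBlock.
Variables (P : {set {set T}}) (B : {set T}).
Hypotheses (tiP : trivIset P) (P0 : set0 \notin P) (BP : B \in P).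
Let X' := cover (P :\ B).

Let dBX : [disjoint B & X'].
Proof. by rewrite /X' coverD1 // disjoint_sym -setI_eq0 setIC setIDA setDIl setDv set0I. Qed.

Let defX : cover P = X' :|: B.
Proof.
rewrite /X' coverD1 //; apply/setP=> x; rewrite !inE.
case: (boolP (x \in B)) => [xB|_]; rewrite ?orbF // orbT.
by apply/bigcupP; exists B.
Qed.

Let Bn0 : B != set0.
Proof. by apply: contraNneq P0 => <-. Qed.

Let disjP A : A \in P :\ B -> [disjoint A & B] /\ A != set0.
Proof.
case/setD1P=> nAB AP; split; first exact: (trivIsetP tiP).
by apply: contraNneq P0 => <-.
Qed.

Let notB Q X : partition Q X -> [disjoint B & X] -> B \notin Q.
Proof.
move=> partQ dX; apply/negP=> BQ; have sBX := partitionS partQ BQ.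
by case/set0Pn: Bn0 => x xB; move: (disjointFr dX xB); rewrite (subsetP sBX).
Qed.

(** First term of the recurrence: B remains a block by itself. *)
Lemma coarsenings_with c :
  [set Q in coarsenings P c.+1 | B \in Q] =
  [set B |: Q | Q in coarsenings (P :\ B) c].
Proof.
apply/setP=> Q; apply/idP/imsetP.
- rewrite !inE => /andP[/and3P[partQ cPQ /eqP cQ] BQ].
  exists (Q :\ B); last by rewrite setD1K.
  rewrite inE coverD1 // partitionD1 //= (cardsD1 B) BQ in cQ *.
  rewrite -(eqn_add2l 1) -[1 + #|_|]/(true + _) cQ eqxx andbT.
  apply/coarserP=> A AP; have [dAB An0] := disjP AP.
  have /(coarserP _ _ cPQ)[D DQ sAD] : A \in P by case/setD1P: AP.
  exists D => //; rewrite !inE DQ andbT; apply: contraTneq dAB => <-.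
  rewrite -setI_eq0; move/setIidPl: sAD => ->; exact: An0.
- case=> Q'; rewrite !inE => /and3P[partQ' cPQ' /eqP cQ'] ->.
  rewrite setU11 andbT cardsU1 (notB partQ' dBX) cQ' eqxx andbT.
  rewrite defX (setUC X') partitionU1 //=.
  apply/coarserP=> A AP; case: (eqVneq A B) => [->|nAB].
    by exists B; rewrite ?setU11.
  have [|D DQ sAD] := coarserP _ _ cPQ' A; first by rewrite !inE nAB.
  by exists D; rewrite // inE DQ orbT.
Qed.

Definition merge_data c :=
  [set p : {set {set T}} * {set T} | (p.1 \in coarsenings (P :\ B) c) && (p.2 \in p.1)].

(** Second term: B lies properly inside a block D of Q, and [D :\: B] is the block that B was merged
    into. *)
Lemma coarsenings_without c :
  [set Q in coarsenings P c | B \notin Q] =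
  [set merge p.1 p.2 B | p in merge_data c].
Proof.
apply/setP=> Q; apply/idP/imsetP.
- rewrite !inE => /andP[/and3P[partQ cPQ /eqP cQ] BQ].
  have [D DQ sBD] := coarserP _ _ cPQ B BP.
  have nDB : D != B by apply: contraNneq BQ => <-.
  pose E := D :\: B.
  have En0 : E != set0.
    by rewrite setD_eq0; apply: contraNN nDB => sDB; rewrite eqEsubset sDB.
  have sED : E \subset D by apply: subsetDl.
  have EQ : E \notin Q :\ D.
    rewrite !inE; apply/negP=> /andP[nED EQ].
    have /disjoint_setI0 := trivIsetP (partition_trivIset partQ) _ _ EQ DQ nED.
    by move/setIidPl: sED => ->; apply/eqP.
  have partQ' : partition (E |: (Q :\ D)) X'.
    have -> : X' = E :|: (cover P :\: D).
      rewrite /X' coverD1 // /E; apply/setP=> x; rewrite !inE.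
      have := subsetP sBD x; have := subsetP (partitionS partQ DQ) x.
      by case: (x \in B); case: (x \in D); case: (x \in cover P) => //= h1 h2;
        first [by have := h1 isT | by have := h2 isT].
    apply: partitionU1 => //; first exact: partitionD1.
    by rewrite -setI_eq0 -subset0; apply/subsetP=> x; rewrite !inE => /andP[/andP[_ ->]].
  exists (E |: (Q :\ D), E); last first.
    rewrite /merge /= setU1K // (_ : E :|: B = D) ?setD1K //.
    apply/setP=> x; rewrite !inE; have := subsetP sBD x.
    by case: (x \in B); case: (x \in D) => // /(_ isT).
  rewrite !inE /= eqxx andbT partQ' /=; apply/andP; split; last first.
    by rewrite cardsU1 EQ -cQ (cardsD1 D Q) DQ.
  apply/coarserP=> A AP; have [dAB An0] := disjP AP.
  have /(coarserP _ _ cPQ)[D' DQ' sAD] : A \in P by case/setD1P: AP.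
  case: (eqVneq D' D) => [eqD|nD]; last by exists D'; rewrite // !inE nD DQ' orbT.
  by exists E; rewrite ?setU11 // subsetD -eqD sAD.
- case=> -[Q' E]; rewrite !inE /= => /andP[/and3P[partQ' cPQ' /eqP cQ'] EQ'] ->.
  rewrite (card_merge partQ' EQ' dBX) cQ' eqxx andbT defX partition_merge //=.
  apply/andP; split.
    apply/coarserP=> A AP; case: (eqVneq A B) => [->|nAB].
      by exists (E :|: B); rewrite ?setU11 ?subsetUr.
    have [|D DQ sAD] := coarserP _ _ cPQ' A; first by rewrite !inE nAB.
    case: (eqVneq D E) => [eqD|nD]; last by exists D; rewrite // !inE nD DQ orbT.
    by exists (E :|: B); rewrite ?setU11 // -eqD subsetU // sAD.
  rewrite !inE negb_or negb_and (notB partQ' dBX) orbT andbT.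
  have /set0Pn[x xE] := partition_neq0 partQ' EQ'.
  apply/eqP=> /setP/(_ x); rewrite inE xE (disjointFl dBX) //.
  exact: (subsetP (partitionS partQ' EQ')).
Qed.

(** The block through a point of B is [E :|: B], which determines E and then the other blocks. *)
Lemma merge_inj c : {in merge_data c &, injective (fun p => merge p.1 p.2 B)}.
Proof.
move=> [Q1 E1] [Q2 E2]; rewrite !inE /=.
move=> /andP[/and3P[part1 _ _] EQ1] /andP[/and3P[part2 _ _] EQ2] eqm.
have ti1 := partition_trivIset (partition_merge part1 EQ1 dBX).
have eqE : E1 :|: B = E2 :|: B.
  case/set0Pn: Bn0 => x xB.
  rewrite -(@def_pblock _ _ (E1 :|: B) x ti1) ?setU11 ?inE ?xB ?orbT //.
  by apply: def_pblock; [|rewrite eqm setU11|rewrite inE xB orbT].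
have EE X Q E : partition Q X -> [disjoint B & X] -> E \in Q -> E = (E :|: B) :\: B.
  move=> partQ dB EQ; rewrite setDUl setDv setU0; apply/esym/setDidPl.
  by rewrite disjoint_sym; apply: disjointWr dB; apply: partitionS EQ.
have eqEE : E1 = E2 by rewrite (EE _ _ _ part1 dBX EQ1) eqE -(EE _ _ _ part2 dBX EQ2).
rewrite -eqEE; congr pair.
have nE X Q E : partition Q X -> [disjoint B & X] -> E \in Q -> E :|: B \notin Q :\ E.
  move=> partQ dB EQ; case/set0Pn: Bn0 => x xB; apply/negP=> /setD1P[_ /(partitionS partQ)].
  by move/subsetP/(_ x); rewrite inE xB orbT (disjointFr dB) // => /(_ isT).
have eqD : Q1 :\ E1 = Q2 :\ E2.
  rewrite -(setU1K (nE _ _ _ part1 dBX EQ1)) -(setU1K (nE _ _ _ part2 dBX EQ2)).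
  by rewrite -/(merge Q1 E1 B) eqm /merge eqE.
by rewrite -(setD1K EQ1) eqD eqEE setD1K.
Qed.

Lemma card_coarsenings_step c :
  #|coarsenings P c.+1| =
  #|coarsenings (P :\ B) c| + c.+1 * #|coarsenings (P :\ B) c.+1|.
Proof.
rewrite -(cardsID [set Q : {set {set T}} | B \in Q]).
rewrite (_ : _ :&: _ = [set Q in coarsenings P c.+1 | B \in Q]); last first.
  by apply/setP=> Q; rewrite !inE.
rewrite (_ : _ :\: _ = [set Q in coarsenings P c.+1 | B \notin Q]); last first.
  by apply/setP=> Q; rewrite !inE andbC.
rewrite coarsenings_with coarsenings_without card_in_imset; last first.
  move=> Q1 Q2; rewrite !inE => /and3P[part1 _ _] /and3P[part2 _ _] eqU.
  by rewrite -(setU1K (notB part1 dBX)) eqU setU1K ?(notB part2).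
congr (_ + _); rewrite (card_in_imset (@merge_inj _)).
rewrite -sum1_card (eq_bigl (fun p =>
  (p.1 \in coarsenings (P :\ B) c.+1) && (p.2 \in p.1))); last first.
  by move=> p; rewrite inE.
rewrite -(pair_big_dep (mem (coarsenings (P :\ B) c.+1)) (fun Q E => E \in Q) (fun _ _ => 1)) /=.
rewrite (eq_bigr (fun=> c.+1)); first by rewrite sum_nat_const mulnC.
by move=> Q; rewrite sum1_card !inE => /and3P[_ _ /eqP].
Qed.

End RemoveBlock.

Lemma card_coarsenings P c :
  trivIset P -> set0 \notin P -> #|coarsenings P c| = stirling2 #|P| c.
Proof.
have [b] := ubnP #|P|; elim: b P c => // b IH P c.
have [-> _ _ _|/set0Pn[B BP]] := eqVneq P set0.
  rewrite cards0 (_ : coarsenings _ _ = if c is 0 then [set set0] else set0).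
    by case: c => [|c]; rewrite ?cards1 ?cards0.
  apply/setP=> Q; rewrite inE /cover big_set0 partition_set0.
  have [->|nQ] := eqVneq Q set0.
    rewrite cards0 (_ : coarser _ _) ?andbT /=; last by apply/coarserP=> B; rewrite inE.
    by case: c => [|c]; rewrite ?inE ?eqxx.
  by case: c => [|c]; rewrite !inE ?(negbTE nQ).
rewrite (cardsD1 B P) BP add1n ltnS => cP tiP P0.
have ti' : trivIset (P :\ B) by apply: trivIsetS tiP; apply: subD1set.
have P0' : set0 \notin P :\ B by rewrite inE (negbTE P0) andbF.
case: c => [|c]; last by rewrite (card_coarsenings_step tiP P0 BP) !IH.
apply/eqP; rewrite cards_eq0; apply/eqP/setP=> Q; rewrite !inE cards_eq0.
apply/negP=> /and3P[partQ cPQ /eqP Q0].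
by have [D] := coarserP _ _ cPQ B BP; rewrite Q0 inE.
Qed.

End Coarsenings.

(** * Flags in a graded poset *)

Section Graded.
Context {d : Order.disp_t} (L : finTBPOrderType d) (r : L -> nat) (N : nat).
(** A candidate rank function, identified with [rk] in [rkE]. By [r_cover] one can climb towards any
    larger element one rank at a time, which is gradedness in the form used below. *)
Hypothesis r_bot : r \bot%O = 0%N.
Hypothesis r_top : r \top%O = N.
Hypothesis r_le : forall x, (r x <= N)%N.
Hypothesis r_cover : forall x y : L, (x < y)%O ->
  exists z, [/\ (x < z)%O, (z <= y)%O & r z = (r x).+1].
Implicit Types (x y z : L) (C : {set L}) (R : pred nat).

Lemma rank_lt x y : (x < y)%O -> (r x < r y)%N.
Proof.
have [m] := ubnP (N - r x); elim: m x => // m IH x le_m lt_xy.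
have [z [lt_xz le_zy rz]] := r_cover lt_xy.
case/comparable_ltgtP: (le_comparable le_zy) => [lt_zy|lt_yz|<-]; last by rewrite rz.
- have := IH z _ lt_zy; have := r_le z; rewrite rz => ? h.
  by apply: ltn_trans (h _); lia.
- by have := lt_le_trans lt_yz le_zy; rewrite ltxx.
Qed.

Lemma rank_le x y : (x <= y)%O -> (r x <= r y)%N.
Proof. by rewrite le_eqVlt => /predU1P[->|/rank_lt/ltnW]. Qed.

Lemma rank_eq x y : (x <= y)%O -> r x = r y -> x = y.
Proof. by rewrite le_eqVlt => /predU1P[//|/rank_lt]; lia. Qed.

Lemma rank_between x y k : (x <= y)%O -> (r x <= k <= r y)%N ->
  exists z, [/\ (x <= z)%O, (z <= y)%O & r z = k].
Proof.
have [m] := ubnP (k - r x); elim: m x => // m IH x le_m le_xy.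
case/andP; rewrite leq_eqVlt => /predU1P[<- _|lt_xk le_ky]; first by exists x.
have lt_xy : (x < y)%O by rewrite lt_neqAle le_xy andbT; apply: contraTneq lt_xk => ->; lia.
have [z [lt_xz le_zy rz]] := r_cover lt_xy.
have [||z' [le_zz' le_z'y rz']] := IH z _ le_zy; try lia.
by exists z'; split=> //; apply: le_trans le_zz'; apply: ltW.
Qed.

Lemma rank_eq0 x : (r x == 0%N) = (x == \bot%O).
Proof.
by apply/eqP/eqP=> [x0|->//]; apply/esym/rank_eq; rewrite ?le0x ?r_bot.
Qed.

Lemma rank_eqN x : (r x == N) = (x == \top%O).
Proof. by apply/eqP/eqP=> [xN|->//]; apply/rank_eq; rewrite ?lex1 ?r_top. Qed.

Lemma chainP C :
  reflect {in C &, forall x y, (x >=< y)%O} (is_chain C).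
Proof.
apply: (iffP forall_inP) => [H x y xC yC|H x xC]; first exact: (forall_inP (H x xC)).
by apply/forall_inP => y yC; apply: H.
Qed.

Lemma chainS C C' : C \subset C' -> is_chain C' -> is_chain C.
Proof. by move/subsetP=> sCC' /chainP H; apply/chainP => x y /sCC' ? /sCC'; apply: H. Qed.

Lemma chainU1 a C : (forall x, x \in C -> (x >=< a)%O) -> is_chain C -> is_chain (a |: C).
Proof.
move=> aC /chainP H; apply/chainP => x y /setU1P[->|xC] /setU1P[->|yC].
- exact: comparablexx.
- by rewrite comparable_sym aC.
- exact: aC.
- exact: H.
Qed.

Lemma chain1 x : is_chain [set x].
Proof. by apply/chainP=> y z /set1P-> /set1P->; apply: comparablexx. Qed.

Lemma chain_le C : is_chain C -> {in C &, forall x y, (r x <= r y)%N -> (x <= y)%O}.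
Proof.
move=> /chainP H x y xC yC le_r; case/comparable_leP: (H x y xC yC) => // /rank_lt; lia.
Qed.

Lemma chain_inj C : is_chain C -> {in C &, injective r}.
Proof.
by move=> H x y xC yC eqr; apply: le_anti; rewrite !(chain_le H) ?eqr.
Qed.

Definition ranks C := [seq r x | x <- enum C].

Lemma size_ranks C : size (ranks C) = #|C|.
Proof. by rewrite size_map cardE. Qed.

Lemma uniq_ranks C : is_chain C -> uniq (ranks C).
Proof.
move=> H; rewrite map_inj_in_uniq ?enum_uniq // => x y.
by rewrite !mem_enum; apply: chain_inj.
Qed.

Lemma mem_ranks C x : x \in C -> r x \in ranks C.
Proof. by move=> xC; apply/mapP; exists x; rewrite ?mem_enum. Qed.

Lemma ranks_sub C R t : {in C, forall x, R (r x) && (r x <= t)%N} ->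
  {subset ranks C <= [seq i <- iota 0 t.+1 | R i]}.
Proof.
move=> H i /mapP[x]; rewrite mem_enum => /H/andP[Rx le_t] ->.
by rewrite mem_filter Rx mem_iota.
Qed.

Lemma chain_card_le C R t : is_chain C -> {in C, forall x, R (r x) && (r x <= t)%N} ->
  (#|C| <= count R (iota 0 t.+1))%N.
Proof.
by move=> cC /ranks_sub; rewrite -size_filter -size_ranks; apply: uniq_leq_size; apply: uniq_ranks.
Qed.

(** Pigeonhole: ranks are distinct on a chain, so a chain with as many elements as there are
    admissible ranks meets them all. *)
Lemma chain_hit C R t i : is_chain C -> {in C, forall x, R (r x) && (r x <= t)%N} ->
  #|C| = count R (iota 0 t.+1) -> R i -> (i <= t)%N -> exists2 x, x \in C & r x = i.
Proof.
move=> cC /ranks_sub sub cardC Ri le_i.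
have [|_ eqi] := uniq_min_size (uniq_ranks cC) sub.
  by rewrite size_filter size_ranks cardC.
have : i \in ranks C by rewrite eqi mem_filter Ri mem_iota.
by case/mapP=> x; rewrite mem_enum => xC ->; exists x.
Qed.

Lemma chain_card_ge C R t :
  (forall i, R i -> (i <= t)%N -> exists2 x, x \in C & r x = i) ->
  (count R (iota 0 t.+1) <= #|C|)%N.
Proof.
move=> H; rewrite -size_filter -size_ranks; apply: uniq_leq_size.
  by rewrite filter_uniq ?iota_uniq.
move=> i; rewrite mem_filter mem_iota => /and3P[Ri _ le_i].
by have [x xC <-] := H i Ri le_i; apply: mem_ranks.
Qed.

Lemma saturated_chain x :
  exists C, [/\ is_chain C, {in C, forall y, (y <= x)%O} & #|C| = (r x).+1].
Proof.
have [m] := ubnP (r x); elim: m x => // m IH x le_m.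
case: (posnP (r x)) => [rx|r0].
  exists [set x]; rewrite cards1 rx; split=> // [|y /set1P->//].
  exact: chain1.
have [|z [_ le_zx rz]] := @rank_between \bot%O x (r x).-1 (le0x _).
  by rewrite r_bot; lia.
have [|C [cC le_C cardC]] := IH z; first by lia.
exists (x |: C); split.
- apply: chainU1 cC => y /le_C le_yz; apply: le_comparable; exact: le_trans le_zx.
- by move=> y /setU1P[->//|/le_C le_yz]; apply: le_trans le_zx.
- rewrite cardsU1 cardC rz prednK // (_ : x \notin C) //.
  by apply/negP=> /le_C/rank_le; lia.
Qed.

Lemma rkE x : rk x = r x.
Proof.
rewrite /rk; set m := \max_(_ | _) _; suff -> : m = (r x).+1 by [].
apply/eqP; rewrite eqn_leq; apply/andP; split.
  apply/bigmax_leqP=> C /andP[cC /forall_inP leC].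
  have -> : (r x).+1 = count predT (iota 0 (r x).+1) by rewrite count_predT size_iota.
  by apply: chain_card_le => // y /leC/rank_le.
have [C [cC leC <-]] := saturated_chain x.
by apply: leq_bigmax_cond; rewrite cC; apply/forall_inP.
Qed.

Lemma max_chain_sizeE : max_chain_size L = N.+1.
Proof.
apply/eqP; rewrite eqn_leq; apply/andP; split.
  apply/bigmax_leqP=> C cC.
  have -> : N.+1 = count predT (iota 0 N.+1) by rewrite count_predT size_iota.
  by apply: chain_card_le => // y _; apply: r_le.
have [C [cC _]] := saturated_chain \top%O; rewrite r_top => <-.
exact: leq_bigmax_cond.
Qed.

(* By injectivity of the rank on chains, the cardinality condition makes the  *)
(* set of ranks equal to the set of all i <= t satisfying R.                  *)
Definition flags R t : {set {set L}} :=
  [set C : {set L} | [&& is_chain C, [forall x in C, R (r x) && (r x <= t)%N]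
                       & #|C| == count R (iota 0 t.+1)]].

Definition with_ends (S : {fset nat}) : pred nat :=
  [pred i : nat | [|| i == 0%N, i == N | i \in S]].

Lemma mem_rank_selection (S : {fset nat}) x :
  (x \in rank_selection L S) = with_ends S (r x).
Proof. by rewrite !inE rkE -rank_eq0 -rank_eqN orbC -orbA. Qed.

(** If a maximal chain skipped an admissible rank i, an element of rank i could be inserted between
    its neighbours in the chain. *)
Lemma maxset_flags (S : {fset nat}) C :
  maxset [pred D : {set L} | is_chain D && (D \subset rank_selection L S)] C ->
  C \in flags (with_ends S) N.
Proof.
case/maxsetP=> /andP[cC /subsetP sC] maxC.
have selC x : x \in C -> with_ends S (r x) by move=> /sC; rewrite mem_rank_selection.
have addC z : with_ends S (r z) -> (forall x, x \in C -> (x >=< z)%O) -> z \in C.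
  move=> Rz cz; rewrite -(maxC (z |: C)) ?setU11 ?subsetUr //=.
  rewrite chainU1 // subUset sub1set mem_rank_selection Rz /=.
  by apply/subsetP.
have botC : \bot%O \in C.
  apply: addC => [|x _]; first by rewrite /with_ends /= r_bot.
  by rewrite comparable_sym le_comparable ?le0x.
have topC : \top%O \in C.
  apply: addC => [|x _]; first by rewrite /with_ends /= r_top eqxx orbT.
  by rewrite le_comparable ?lex1.
have rC : {in C, forall x, with_ends S (r x) && (r x <= N)%N}.
  by move=> x xC; rewrite selC ?r_le.
rewrite inE cC andTb; apply/andP; split; first exact/forall_inP.
rewrite eqn_leq chain_card_le //; apply: chain_card_ge => i Ri le_i.
case: (boolP [exists x in C, r x == i]) => [/exists_inP[x xC /eqP]|]; first by exists x.
rewrite negb_exists_in => /forall_inP noti.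
have i0 : (0 < i)%N by have := noti _ botC; rewrite r_bot; lia.
have iN : (i < N)%N by have := noti _ topC; rewrite r_top; lia.
(* x and y are the elements of C with ranks closest to i from below and above. *)
have [|x /andP[xC ltx] maxx] := @arg_maxnP L \bot%O [pred x | (x \in C) && (r x < i)%N] r.
  by rewrite /= botC r_bot.
have [|y /andP[yC lty] miny] := @arg_minnP L \top%O [pred x | (x \in C) && (i < r x)%N] r.
  by rewrite /= topC r_top.
have [||z [le_xz le_zy rz]] := @rank_between x y i; try lia.
  by apply: (chain_le cC) => //; lia.
have zC : z \in C.
  apply: addC => [|c cC']; first by rewrite rz.
  case: (ltngtP (r c) i) => [lt_c|gt_c|eq_c]; last by have := noti _ cC'; rewrite eq_c eqxx.
    apply: le_comparable; apply: le_trans le_xz; apply: (chain_le cC) => //.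
    by apply: maxx; rewrite /= cC'.
  rewrite comparable_sym; apply: le_comparable; apply: (le_trans le_zy).
  by apply: (chain_le cC) => //; apply: miny; rewrite /= cC'.
by have := noti _ zC; rewrite rz eqxx.
Qed.

Lemma alphaE (S : {fset nat}) : alpha L S = #|flags (with_ends S) N|.
Proof.
apply: eq_card => C; rewrite [LHS]inE; apply/idP/idP; first exact: maxset_flags.
rewrite inE => /and3P[cC /forall_inP rC /eqP cardC]; apply/maxsetP; split=> [|D].
  by rewrite /= cC; apply/subsetP=> x /rC/andP[]; rewrite mem_rank_selection.
(* A flag already has the largest cardinality of a chain in the rank selection. *)
case/andP=> cD /subsetP sD sCD; apply/esym/eqP; rewrite eqEcard sCD cardC.
apply: chain_card_le => // x xD; rewrite r_le andbT.
by rewrite -mem_rank_selection sD.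
Qed.

Lemma last_belowP R t : R 0%N -> R (last_below R t).
Proof. by move=> R0; elim: t => //= t IH; case: ifP. Qed.

Lemma last_below_max R t i : R i -> (i <= t)%N -> (i <= last_below R t)%N.
Proof.
move=> Ri; elim: t => //= t IH; case: ifP => // nR.
by rewrite leq_eqVlt ltnS => /predU1P[eqi|/IH//]; rewrite eqi nR in Ri.
Qed.

Lemma card_flags0 R : R 0%N -> #|flags R 0| = 1%N.
Proof.
move=> R0; rewrite -(cards1 [set \bot%O : L]); apply: eq_card => C.
rewrite !inE /= R0 /=; apply/and3P/eqP=> [[_ /forall_inP rC /cards1P[x eqC]]|->].
  have /rC : x \in C by rewrite eqC set11.
  by rewrite leqn0 rank_eq0 => /andP[_ /eqP <-].
split; last by rewrite cards1.
  exact: chain1.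
by apply/forall_inP=> x /set1P->; rewrite r_bot R0.
Qed.

Lemma count_iotaS R t :
  count R (iota 0 t.+2) = (count R (iota 0 t.+1) + R t.+1)%N.
Proof. by rewrite -[t.+2]addn1 iotaD count_cat /= addn0. Qed.

Lemma flagsS_notin R t : ~~ R t.+1 -> flags R t.+1 = flags R t.
Proof.
move=> nR; apply/setP=> C; rewrite !inE count_iotaS (negbTE nR) addn0.
congr [&& _, _ & _]; apply: eq_forallb_in => x _.
rewrite [in LHS]leq_eqVlt ltnS andb_orr.
by case: eqP => [->|_]; rewrite ?(negbTE nR) ?andbF.
Qed.

(** A flag up to t+1 is a flag up to t with an upper bound of rank t+1 added. Being an upper bound
    depends only on the top of the flag, whose rank is [last_below R t]. *)
Lemma card_flagsS R t w : R 0%N -> R t.+1 ->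
  (forall x, (r x <= t)%N -> #|[set y | (x <= y)%O && (r y == t.+1)]| = w (r x)) ->
  #|flags R t.+1| = (#|flags R t| * w (last_below R t))%N.
Proof.
move=> R0 Rt wE.
pose E := [set p : {set L} * L |
  (p.1 \in flags R t) && [forall x in p.1, x <= p.2]%O && (r p.2 == t.+1)].
have rlt C x : C \in flags R t -> x \in C -> (r x <= t)%N.
  by rewrite inE => /and3P[_ /forall_inP rC _] /rC/andP[].
have -> : flags R t.+1 = [set p.2 |: p.1 | p in E].
  apply/setP=> C; apply/idP/imsetP.
  - rewrite inE count_iotaS Rt => /and3P[cC /forall_inP rC /eqP cardC].
    have [|x xC rx] := chain_hit cC rC _ Rt (leqnn _).
      by rewrite cardC count_iotaS Rt.
    exists (C :\ x, x); last by rewrite setD1K.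
    have lt_x y : y \in C -> y != x -> (r y < t.+1)%N.
      move=> yC nyx; have /andP[_] := rC _ yC; rewrite leq_eqVlt -rx.
      by case/predU1P=> // /(chain_inj cC yC xC)/eqP; rewrite (negbTE nyx).
    rewrite inE; apply/andP; split; last by rewrite rx.
    apply/andP; split; last first.
      apply/forall_inP=> y /setD1P[nyx yC]; apply: (chain_le cC) => //.
      by rewrite rx ltnW ?lt_x.
    rewrite inE; apply/and3P; split.
    + by apply: chainS cC; apply: subD1set.
    + by apply/forall_inP=> y /setD1P[nyx yC]; have /andP[-> _] := rC _ yC; apply: lt_x.
    + by move/eqP: cardC; rewrite (cardsD1 x) xC addnC eqn_add2r.
  - case=> -[C' y]; rewrite inE /= => /andP[/andP[C'f /forall_inP le_y] /eqP ry] ->.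
    have rC' := rlt _ _ C'f; move: (C'f); rewrite !inE.
    case/and3P=> cC' /forall_inP rC /eqP cardC.
    rewrite count_iotaS Rt -cardC cardsU1 addnC chainU1 //=; last first.
      by move=> x /le_y/le_comparable.
    rewrite (_ : y \notin C') ?addn1 ?eqxx ?andbT; last first.
      by apply/negP=> /rC'; rewrite ry ltnn.
    apply/forall_inP=> x /setU1P[->|xC']; first by rewrite ry Rt /=.
    by have /andP[-> /leqW->] := rC x xC'.
rewrite card_in_imset; last first.
  move=> [C1 y1] [C2 y2]; rewrite !inE /= -/(flags R t).
  move=> /andP[/andP[C1f _] /eqP ry1] /andP[/andP[C2f _] /eqP ry2] eqU.
  have {C1f} r1 x : x \in C1 -> (r x < t.+1)%N by apply: rlt; rewrite inE.
  have {C2f} r2 x : x \in C2 -> (r x < t.+1)%N by apply: rlt; rewrite inE.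
  have eqy : y1 = y2.
    have : y1 \in y2 |: C2 by rewrite -eqU setU11.
    by case/setU1P=> // /r2; rewrite ry1 ltnn.
  rewrite -eqy in ry2 eqU *; congr pair.
  rewrite -(@setU1K _ y1 C1) ?eqU ?setU1K //.
    by apply/negP=> /r2; rewrite ry1 ltnn.
  by apply/negP=> /r1; rewrite ry1 ltnn.
rewrite -sum1_card (eq_bigl (fun p => (p.1 \in flags R t) &&
   ([forall x in p.1, x <= p.2]%O && (r p.2 == t.+1)))); last first.
  by move=> p; rewrite inE andbA.
rewrite -(pair_big_dep (mem (flags R t))
  (fun C y => [forall x in C, x <= y]%O && (r y == t.+1)) (fun _ _ => 1%N)) /=.
rewrite (eq_bigr (fun=> w (last_below R t))) ?sum_nat_const // => C Cf.
have := Cf; rewrite inE => /and3P[cC /forall_inP rC /eqP cardC].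
have le_l := last_below_le R t.
have [z zC rz] := chain_hit cC rC cardC (last_belowP t R0) le_l.
rewrite -rz -wE ?rz // -sum1_card; apply: eq_bigl => y; rewrite inE; congr andb.
apply/forall_inP/idP=> [/(_ z zC)//|le_zy x xC].
apply: le_trans le_zy; apply: (chain_le cC) => //.
by rewrite rz; have /andP[Rx ?] := rC x xC; apply: last_below_max.
Qed.


(** * Chains enumerated by size and rank set *)

Section ChainSum.
Variable (F : comPzRingType).
Implicit Types (u : F).

(** Adding a to a chain that avoids it is a bijection onto the chains through a, so the latter sum
    is u times the sum over chains avoiding a. *)
Lemma chain_sum_extremum a (Q : pred {set L}) u :
  (forall x, (x >=< a)%O) -> (forall C, Q (a |: C) = Q C) ->
  u * \sum_(C : {set L} | is_chain C && Q C) u ^+ #|C| =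
  (1 + u) * \sum_(C : {set L} | is_chain C && Q C && (a \in C)) u ^+ #|C|.
Proof.
move=> ca Qa; rewrite (bigID (fun C : {set L} => a \in C)) /= mulrDr mulrDl mul1r addrC.
congr (_ + _); rewrite big_distrr /=.
rewrite (reindex_onto (fun C => C :\ a) (fun C => a |: C)) /=; last first.
  by move=> C /andP[_ aC]; rewrite setU1K.
apply: eq_big => [C|C].
- rewrite !inE eqxx /= andbT; case: (boolP (a \in C)) => aC; last first.
    rewrite andbF; apply/negP=> /andP[_ /eqP eqC].
    by move: aC; rewrite -eqC setU11.
  rewrite setD1K // eqxx !andbT -(Qa (_ :\ _)) setD1K //; congr andb.
  apply/idP/idP; last by apply: chainS; apply: subD1set.
  by move=> cC; rewrite -(setD1K aC) chainU1.
- case/andP=> _ /eqP <-; rewrite setU1K ?inE ?eqxx //.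
  by rewrite -exprS cardsU1 !inE eqxx.
Qed.

(** Indices start at 0, so i encodes the rank i+1 and J ranges over the subsets of [N-1]. *)
Definition inner_ranks (J : {set 'I_N.-1}) : {fset nat} :=
  [fset i.+1 | i : 'I_N.-1 in J]%fset.

Lemma mem_inner_ranks (J : {set 'I_N.-1}) (i : 'I_N.-1) :
  (i.+1 \in inner_ranks J) = (i \in J).
Proof.
apply/imfsetP/idP => [[j /= jJ [/ord_inj ->]]//|iJ]; by exists i.
Qed.

Hypothesis N_gt0 : (0 < N)%N.

Lemma count_inner_ranks (J : {set 'I_N.-1}) :
  count (with_ends (inner_ranks J)) (iota 0 N.+1) = #|J|.+2.
Proof.
have split_ends R m : (0 < m)%N ->
    count R (iota 0 m.+1) = (R 0 + count R (iota 1 m.-1) + R m)%N.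
  by case: m => // m _; rewrite count_iotaS.
rewrite split_ends // /with_ends /= eqxx orbT add1n addn1.
congr _.+2; rewrite (iotaDl 1 0) count_map -val_enum_ord count_map.
rewrite -sum1_card -sum1_count big_enum_cond; apply: eq_bigl => i /=.
rewrite add1n mem_inner_ranks (_ : _ == N = false) //.
by apply/eqP=> eqN; have := ltn_ord i; rewrite -ltnS eqN prednK // ltnn.
Qed.

Lemma mem_inner_flags (J : {set 'I_N.-1}) C :
  (C \in flags (with_ends (inner_ranks J)) N) =
  [&& is_chain C, \bot%O \in C, \top%O \in C &
      [set i : 'I_N.-1 | [exists x in C, r x == i.+1]] == J].
Proof.
set R := with_ends _.
have R0 : R 0%N by [].
have RN : R N by rewrite /R /with_ends /= eqxx orbT.
have RJ (i : 'I_N.-1) : R i.+1 = (i \in J).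
  rewrite /R /with_ends /= mem_inner_ranks (_ : _ == N = false) //.
  by apply/eqP=> eqN; have := ltn_ord i; rewrite -ltnS eqN prednK // ltnn.
apply/idP/idP.
- rewrite inE => /and3P[cC /forall_inP rC /eqP cardC]; rewrite cC.
  have hit := chain_hit cC rC cardC.
  have [x0 x0C /eqP] := hit _ R0 (leq0n _); rewrite rank_eq0 => /eqP eq0.
  have [xN xNC /eqP] := hit _ RN (leqnn _); rewrite rank_eqN => /eqP eqN.
  rewrite -eq0 x0C -eqN xNC /=; apply/eqP/setP=> i; rewrite inE -RJ.
  apply/exists_inP/idP=> [[x xC /eqP <-]|Ri]; first by have /andP[] := rC x xC.
  have [|x xC rx] := hit _ Ri; last by exists x; rewrite ?rx.
  by rewrite -[X in (_ <= X)%N](prednK N_gt0) ltnS ltnW.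
- case/and4P=> cC botC topC /eqP eqJ.
  have rC : {in C, forall x, R (r x) && (r x <= N)%N}.
    move=> x xC; rewrite r_le andbT.
    case: (posnP (r x)) => [->//|rx0]; case: (eqVneq (r x) N) => [->//|rxN].
    have lt_rx : ((r x).-1 < N.-1)%N by have := r_le x; lia.
    have := RJ (Ordinal lt_rx); rewrite /= prednK // => ->; rewrite -eqJ inE.
    by apply/exists_inP; exists x; rewrite //= prednK.
  rewrite inE cC andTb; apply/andP; split; first exact/forall_inP.
  rewrite eqn_leq chain_card_le //; apply: chain_card_ge => i Ri le_i.
  case: (posnP i) => [->|i0]; first by exists \bot%O.
  case: (eqVneq i N) => [->|iN]; first by exists \top%O.
  have lt_i : (i.-1 < N.-1)%N by lia.
  have := RJ (Ordinal lt_i); rewrite /= prednK // Ri -eqJ inE => /esym/exists_inP[x xC].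
  by rewrite /= prednK // => /eqP; exists x.
Qed.

Lemma chain_sum_ends u :
  \sum_(C : {set L} | [&& is_chain C, \bot%O \in C & \top%O \in C]) u ^+ #|C| =
  \sum_(J : {set 'I_N.-1}) (alpha L (inner_ranks J))%:R * u ^+ #|J|.+2.
Proof.
rewrite (partition_big (fun C : {set L} =>
  [set i : 'I_N.-1 | [exists x in C, r x == i.+1]]) predT) //=.
apply: eq_bigr => J _; rewrite alphaE mulr_natl -sumr_const.
apply: eq_big => C; first by rewrite mem_inner_flags !andbA.
rewrite -andbA -andbA -mem_inner_flags inE => /and3P[_ _ /eqP->].
by rewrite count_inner_ranks.
Qed.

(** [chain_sum_extremum] is applied at the bottom, then at the top; [N_gt0] makes them distinct. *)
Lemma chain_sumE u :
  u ^+ 2 * \sum_(C : {set L} | is_chain C) u ^+ #|C| =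
  (1 + u) ^+ 2 * \sum_(J : {set 'I_N.-1}) (alpha L (inner_ranks J))%:R * u ^+ #|J|.+2.
Proof.
have bot_top : (\bot%O == \top%O :> L) = false.
  by apply/negbTE/eqP=> bt; have := r_top; rewrite -bt r_bot; lia.
rewrite -chain_sum_ends !expr2 -!mulrA.
have botE : u * \sum_(C : {set L} | is_chain C) u ^+ #|C| =
    (1 + u) * \sum_(C : {set L} | is_chain C && (\bot%O \in C)) u ^+ #|C|.
  have cbot x : (x >=< \bot)%O by rewrite comparable_sym le_comparable ?le0x.
  have := @chain_sum_extremum \bot%O predT u cbot (fun=> erefl).
  rewrite (eq_bigl (fun C : {set L} => is_chain C)) => [->|C]; last by rewrite andbT.
  by congr (_ * _); apply: eq_bigl => C; rewrite andbT.
rewrite botE.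
rewrite mulrCA; congr (_ * _).
rewrite (chain_sum_extremum (a := \top%O) (Q := fun C => \bot%O \in C)).
- by congr (_ * _); apply: eq_bigl => C; rewrite andbA.
- by move=> x; rewrite le_comparable ?lex1.
- by move=> C; rewrite !inE bot_top.
Qed.

End ChainSum.

End Graded.

(** * The lattice of set partitions *)

Section SetPartitions.
Local Open Scope nat_scope.
Variable n : nat.
Hypothesis n_gt0 : 0 < n.
Implicit Types P Q : setpart n.

Definition sp_rank P : nat := n - #|blocks P|.

Lemma card_blocks_le P : #|blocks P| <= n.
Proof.
rewrite -[leqRHS](card_ord n) -cardsT (card_partition (blocksP P)) -sum1_card.
by apply: leq_sum => B BP; rewrite card_gt0 (partition_neq0 (blocksP P)).
Qed.

Lemma card_blocks_gt0 P : 0 < #|blocks P|.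
Proof.
rewrite card_gt0; apply/set0Pn; exists (pblock (blocks P) (Ordinal n_gt0)).
by rewrite pblock_mem // (cover_partition (blocksP P)) inE.
Qed.

Lemma sp_rank_bot : sp_rank \bot%O = 0.
Proof. by rewrite /sp_rank /= card_imset ?card_ord ?subnn //; apply: set1_inj. Qed.

Lemma sp_rank_top : sp_rank \top%O = n.-1.
Proof.
rewrite /sp_rank /= (_ : _ :\ _ = [set setT]) ?cards1 ?subn1 //.
apply/setP=> B; rewrite !inE; case: (eqVneq B setT) => [->|_]; rewrite ?andbF // andbT.
by apply/set0Pn; exists (Ordinal n_gt0).
Qed.

Lemma sp_rank_le P : sp_rank P <= n.-1.
Proof. by rewrite /sp_rank; have := card_blocks_gt0 P; lia. Qed.

Lemma le_setpartE P Q : (P <= Q)%O = coarser (blocks P) (blocks Q).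
Proof. by []. Qed.

(** Some block D of Q is not a block of P, since otherwise Q would refine P; D then contains two
    blocks of P. *)
Lemma setpart_lt_split P Q : (P < Q)%O ->
  exists D B1 B2, [/\ D \in blocks Q, B1 \in blocks P, B2 \in blocks P, B1 != B2 &
                      (B1 \subset D) && (B2 \subset D)].
Proof.
move=> lt_PQ; have le_PQ := ltW lt_PQ.
have covQ := cover_partition (blocksP Q); have covP := cover_partition (blocksP P).
have tiQ := partition_trivIset (blocksP Q); have tiP := partition_trivIset (blocksP P).
case: (boolP (blocks Q \subset blocks P)) => [/subsetP sQP|/subsetPn[D DQ DnP]].
  have : (Q <= P)%O by apply/refinesP=> B BQ; exists B; rewrite ?sQP.
  by move=> le_QP; have := lt_le_trans lt_PQ le_QP; rewrite ltxx.
have sub x : x \in D -> pblock (blocks P) x \in blocks P /\ pblock (blocks P) x \subset D.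
  move=> xD; have xP : pblock (blocks P) x \in blocks P by rewrite pblock_mem ?covP.
  split=> //; have [E EQ sE] := refinesP _ _ le_PQ _ xP.
  have xE : x \in E by rewrite (subsetP sE) // mem_pblock covP.
  by rewrite -(def_pblock tiQ DQ xD) (def_pblock tiQ EQ xE).
have /set0Pn[x xD] := partition_neq0 (blocksP Q) DQ.
have [B1P sB1] := sub x xD.
have /subsetPn[y yD yB1] : ~~ (D \subset pblock (blocks P) x).
  apply: contraNN DnP => sD; rewrite (_ : D = pblock (blocks P) x) //.
  by apply/eqP; rewrite eqEsubset sD.
have [B2P sB2] := sub y yD.
exists D, (pblock (blocks P) x), (pblock (blocks P) y); split; rewrite ?sB1 //.
by apply: contraNneq yB1 => ->; rewrite mem_pblock covP.
Qed.

(** Merge two blocks of P that lie in a common block of Q. *)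
Lemma sp_rank_cover P Q : (P < Q)%O ->
  exists U, [/\ (P < U)%O, (U <= Q)%O & sp_rank U = (sp_rank P).+1].
Proof.
move=> lt_PQ; have le_PQ := ltW lt_PQ.
have [D [B1 [B2 [DQ B1P B2P n12 /andP[s1 s2]]]]] := setpart_lt_split lt_PQ.
have part1 := partitionD1 (blocksP P) B1P.
have B2P1 : B2 \in blocks P :\ B1 by rewrite !inE eq_sym n12.
have dis : [disjoint B1 & [set: 'I_n] :\: B1].
  by rewrite -setI_eq0; apply/eqP/setP=> x; rewrite !inE andbA andbN.
have partU : partition (merge (blocks P :\ B1) B2 B1) [set: 'I_n].
  rewrite (_ : [set: _] = [set: 'I_n] :\: B1 :|: B1) ?partition_merge //.
  by apply/setP=> x; rewrite !inE andbT orNb.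
have cardU : #|merge (blocks P :\ B1) B2 B1| = #|blocks P|.-1.
  by rewrite (card_merge part1 B2P1 dis) (cardsD1 B1 (blocks P)) B1P.
have rU : sp_rank (SetPart partU) = (sp_rank P).+1.
  rewrite /sp_rank [blocks _]/= cardU.
  by move: #|_| (card_blocks_gt0 P) (card_blocks_le P) => b; clear; lia.
exists (SetPart partU); split=> //.
- rewrite lt_neqAle; apply/andP; split.
    by apply/eqP=> eqU; move: rU; rewrite -eqU => /n_Sn.
  apply/refinesP=> B BP /=; case: (boolP ((B == B1) || (B == B2))) => [B12|].
    by exists (B2 :|: B1); rewrite ?setU11 //; case/orP: B12 => /eqP->; rewrite ?subsetUl ?subsetUr.
  by rewrite negb_or => /andP[nB1 nB2]; exists B; rewrite // !inE nB1 nB2 BP orbT.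
- apply/refinesP=> B /= /setU1P[->|]; first by exists D; rewrite // subUset s1 s2.
  by case/setD1P=> _ /setD1P[_]; apply: (refinesP _ _ le_PQ).
Qed.

Lemma card_upper P t : t.+1 < n ->
  #|[set Q | (P <= Q)%O && (sp_rank Q == t.+1)]| = stirling2 (n - sp_rank P) (n - t.+1).
Proof.
move=> lt_tn; have leP := card_blocks_le P.
have rE Q : (sp_rank Q == t.+1) = (#|blocks Q| == n - t.+1).
  by rewrite /sp_rank; move: #|_| (card_blocks_le Q) lt_tn => b; clear; lia.
have -> : n - sp_rank P = #|blocks P| by rewrite /sp_rank subKn.
rewrite -card_coarsenings; last 2 first.
- exact: partition_trivIset (blocksP P).
- by rewrite (partition0 (blocksP P)).
rewrite -(card_imset _ (@val_inj _ _ (setpart n))); apply: eq_card => X; apply/imsetP/idP.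
- case=> Q; rewrite inE => /andP[le_PQ rQ] ->; rewrite inE -le_setpartE le_PQ.
  by rewrite (cover_partition (blocksP P)) (blocksP Q) -rE.
- rewrite inE (cover_partition (blocksP P)) => /and3P[partX le_X cX].
  by exists (SetPart partX); rewrite // inE le_setpartE le_X rE.
Qed.

Lemma alpha_setpart (S : {fset nat}) : 2 <= n ->
  alpha (setpart n) S = count (ok (with_ends n.-1 S)) (A n).
Proof.
move=> n2; set R := with_ends _ _.
have R0 : R 0 by [].
have Rn : R n.-1 by rewrite /R /with_ends /= eqxx orbT.
rewrite (alphaE sp_rank_bot sp_rank_top sp_rank_le sp_rank_cover) -/R.
have DS t : t.+1 < n -> #|flags sp_rank R t.+1| =
    if R t.+1 then #|flags sp_rank R t| * stirling2 (n - last_below R t) (n - t.+1)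
    else #|flags sp_rank R t|.
  move=> lt_tn; case: ifP => Rt; last by rewrite flagsS_notin ?Rt.
  rewrite (card_flagsS sp_rank_bot sp_rank_top sp_rank_le sp_rank_cover R0 Rt
    (w := fun i => stirling2 (n - i) (n - t.+1))) //.
  by move=> P _; apply: card_upper.
rewrite (@count_ok_flags n R (fun t => #|flags sp_rank R t|)) //; last first.
  exact: (card_flags0 sp_rank_bot sp_rank_top sp_rank_le sp_rank_cover).
(* Passing from rank n-2 to the top rank n-1 multiplies the count by S(., 1) = 1. *)
have lt_n : n.-2.+1 < n by lia.
have := DS _ lt_n; rewrite (_ : n.-2.+1 = n.-1) ?Rn; last by lia.
have le_l := last_below_le R n.-2.
have -> : n - n.-1 = 1 by lia.
by have -> : n - last_below R n.-2 = (n - last_below R n.-2).-1.+1; rewrite ?stirling2n1 ?muln1; lia.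
Qed.

End SetPartitions.

(** * Inclusion-exclusion *)

Lemma fpowerset_moebius (K : choiceType) (E S : {fset K}) :
  \sum_(T <- fpowerset S) (-1) ^+ #|` (S `\` T)%fset| * (E `<=` T)%fset%:Z = (E == S)%:Z.
Proof.
case: (boolP (E `<=` S)%fset) => [sES|nES]; last first.
  rewrite big1_seq => [|T /andP[_]].
    by rewrite (_ : E == S = false) //; apply: contraNF nES => /eqP->.
  rewrite fpowersetE => sTS; rewrite (_ : (E `<=` T)%fset = false) ?mulr0 //.
  by apply: contraNF nES => sET; apply: fsubset_trans sTS.
case: (eqVneq E S) => [->|nES].
  have SS : S \in fpowerset S by rewrite fpowersetE fsubset_refl.
  rewrite (bigD1_seq S SS) ?fset_uniq //= fsetDv cardfs0 expr0 fsubset_refl.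
  rewrite big1_seq ?addr0 // => T /andP[nTS]; rewrite fpowersetE => sTS.
  by rewrite (_ : (S `<=` T)%fset = false) ?mulr0 //; 
  apply: contraNF nTS => sST; rewrite eqEfsubset sTS.
have /fsubsetPn[a aS aE] : ~~ (S `<=` E)%fset.
  by apply: contraNN nES => sSE; rewrite eqEfsubset sES.
(* Toggling a is a sign-reversing involution. *)
pose tau (T : {fset K}) := if a \in T then (T `\ a)%fset else (a |` T)%fset.
have tauK : involutive tau.
  move=> T; rewrite /tau; case: (boolP (a \in T)) => aT.
    by rewrite !inE eqxx fsetD1K.
  by rewrite fset1U1 fsetU1K.
have tauP : perm_eq [seq tau T | T <- fpowerset S] (fpowerset S).
  apply: uniq_perm; rewrite ?(map_inj_uniq (inv_inj tauK)) ?fset_uniq // => T.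
  rewrite -{1}[T]tauK (mem_map (inv_inj tauK)) !fpowersetE /tau.
  case: ifP => aT; last by rewrite fsubUset fsub1set aS.
  apply/idP/idP => [sT|]; last by apply: fsubset_trans; apply: fsubD1set.
  by rewrite -(fsetD1K aT) fsubUset fsub1set aS.
pose f T : int := (-1) ^+ #|` (S `\` T)%fset| * (E `<=` T)%fset%:Z.
rewrite -[LHS]/(\sum_(T <- fpowerset S) f T).
suff : \sum_(T <- fpowerset S) f T = - \sum_(T <- fpowerset S) f T by lia.
rewrite -[LHS](perm_big _ tauP) /= big_map -sumrN; apply: eq_bigr => T _.
rewrite /f /tau -mulNr; case: ifP => aT; congr (_ * _%:Z).
- have -> : (S `\` (T `\ a) = a |` (S `\` T))%fset.
    apply/fsetP=> x; rewrite !inE; case: (eqVneq x a) => [->|]; rewrite ?aS ?orbF //=.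
  by rewrite cardfsU1 !inE aT /= exprS mulN1r.
- rewrite fsubsetD1 aE andbT //.
- rewrite [in RHS](cardfsD1 a) !inE aT aS exprS mulN1r opprK.
  congr (_ ^+ #|` _|); apply/fsetP=> x; rewrite !inE negb_or andbA.
  by [].
- congr nat_of_bool; apply/fsubsetP/fsubsetP => sE x xE; last by rewrite !inE sE ?orbT.
  by have := sE x xE; rewrite !inE; case/predU1P=> // eqx; rewrite -eqx xE in aE.
Qed.

(** Expand a product over I whose factors are x + 0 on E and x + (1-x) = 1 elsewhere. *)
Lemma superset_sum (F : comPzRingType) (I : finType) (E : {set I}) (x : F) :
  \sum_(J : {set I}) (E \subset J)%:R * (x ^+ #|J| * (1 - x) ^+ (#|I| - #|J|)) = x ^+ #|E|.
Proof.
pose G i : F := if i \in E then 0 else 1 - x.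
transitivity (\prod_(i : I) (x + G i)).
  rewrite bigA_distr; apply: eq_big => [J|J _]; first by rewrite inE.
  rewrite (bigID (fun i => i \in J)) /=.
  rewrite (eq_bigr (fun=> x)) => [|i ->] //; rewrite prodr_const.
  rewrite [in RHS](eq_bigr G) => [|i /negbTE ->] //.
  case: (boolP (E \subset J)) => [sEJ|/subsetPn[i iE iJ]].
    rewrite mul1r (eq_bigr (fun=> 1 - x)) => [|i iJ]; last first.
      by rewrite /G (contraNF (subsetP sEJ i)).
    by rewrite prodr_const -(cardC (mem J)) addKn.
  by rewrite mul0r (bigD1 i) //= /G iE mul0r mulr0.
rewrite -prodr_const [RHS]big_mkcond; apply: eq_bigr => i _.
by rewrite /G; case: ifP; rewrite ?addr0 // addrC subrK.
Qed.

(** * Descent sets and the h-polynomial *)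

Definition coDes (n : nat) (s : seq nat) : {fset nat} :=
  [fset (n - 1 - i)%N | i in Des s]%fset.

Lemma size_A n s : s \in A n -> size s = n.-1.
Proof. exact: size_tail_words. Qed.

Lemma mem_Des s i : (i \in Des s) =
  (0 < i < size s)%N && (nth 0 s i <= nth 0 s i.-1)%N.
Proof.
rewrite !inE mem_iota; case: (size s) => [|m] /=; last by rewrite add1n.
by rewrite ltn0 andbF; case: i.
Qed.

Lemma mem_coDes n s i : s \in A n ->
  (i \in coDes n s) = (0 < i < n.-1)%N && (n - 1 - i \in Des s)%N.
Proof.
move=> /size_A sizes; apply/imfsetP/andP => [[j /= jD ->]|[hi iD]].
  have := jD; rewrite mem_Des sizes => /andP[hj _].
  by rewrite subKn ?jD; lia.
by exists (n - 1 - i)%N => //=; rewrite subKn //; lia.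
Qed.

(** Reflected descents lie strictly between 0 and n-1, so the ends added to S change nothing. *)
Lemma ok_coDes n (S : {fset nat}) s : s \in A n ->
  ok (with_ends n.-1 S) s = (coDes n s `<=` S)%fset.
Proof.
move=> sA; have sizes := size_A sA.
rewrite okP sizes; apply/allP/fsubsetP => [H i|sub i].
  rewrite mem_coDes // mem_Des sizes => /and3P[hi hni desi].
  have := H (n - 1 - i)%N; rewrite mem_iota => /(_ ltac:(lia)).
  rewrite [X in _ || X]ltnNge desi orbF /with_ends /= (_ : n.-1 - _ = i)%N; last by lia.
  by case/andP: hi => i_gt0 lt_i; rewrite (gtn_eqF i_gt0) (ltn_eqF lt_i).
rewrite mem_iota => hi; rewrite ltnNge orbC -implybE; apply/implyP=> desi.
rewrite /with_ends /= sub ?orbT // mem_coDes // mem_Des sizes.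
rewrite (_ : n - 1 - _ = i)%N ?desi ?andbT; lia.
Qed.

Lemma coDes_eq n (S : {fset nat}) s : s \in A n -> {subset S <= iota 1 (n - 2)} ->
  (Des s == [fset (n - 1 - x)%N | x in S]%fset) = (coDes n s == S).
Proof.
move=> sA sS; have rS x : x \in S -> (0 < x < n.-1)%N by move/sS; rewrite mem_iota; lia.
have rD x : x \in Des s -> (0 < x < n.-1)%N by rewrite mem_Des (size_A sA) => /andP[].
apply/eqP/eqP=> [eqD|<-]; apply/fsetP=> x.
  rewrite mem_coDes // eqD; apply/andP/idP=> [[hx /imfsetP[y /= yS]]|xS].
    by have := rS _ yS => hy eqx; rewrite (_ : x = y) //; lia.
  by split; [exact: rS|apply/imfsetP; exists x].
apply/idP/imfsetP=> [xD|[y /= yD ->]]; last by move: yD; rewrite mem_coDes // => /andP[].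
exists (n - 1 - x)%N; last by have := rD _ xD; lia.
rewrite /= mem_coDes // (_ : n - 1 - (n - 1 - x) = x)%N ?xD ?andbT;
  by have := rD _ xD; lia.
Qed.

Definition coDes_ord n (s : seq nat) : {set 'I_n.-1.-1} :=
  [set i : 'I_n.-1.-1 | i.+1 \in coDes n s].

Lemma coDes_ord_sub n (J : {set 'I_n.-1.-1}) s : s \in A n ->
  (coDes n s `<=` inner_ranks J)%fset = (coDes_ord n s \subset J).
Proof.
move=> sA; apply/fsubsetP/subsetP => sub i.
  by rewrite inE => /sub; rewrite mem_inner_ranks.
move=> iD; have := iD; rewrite mem_coDes // => /andP[hi _].
have lt_i : (i.-1 < n.-1.-1)%N by lia.
have def_i : i = (Ordinal lt_i).+1 by rewrite /= prednK //; lia.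
by rewrite def_i mem_inner_ranks sub // inE -def_i.
Qed.

Lemma card_coDes_ord n s : s \in A n -> #|coDes_ord n s| = des s.
Proof.
move=> sA; rewrite /des; set E := coDes_ord n s.
have <- : [fset (n - 1 - i.+1)%N | i : 'I_n.-1.-1 in E]%fset = Des s.
  apply/fsetP=> x; apply/imfsetP/idP => [[i /=]|xD].
    by rewrite inE mem_coDes // => /andP[_ iD] ->.
  have := xD; rewrite mem_Des (size_A sA) => /andP[hx _].
  have lt_x : (n - 1 - x.+1 < n.-1.-1)%N by lia.
  exists (Ordinal lt_x) => /=; last by lia.
  rewrite inE /= (_ : (n - 1 - x.+1).+1 = n - 1 - x)%N; last by lia.
  by rewrite mem_coDes // subKn ?xD ?andbT; lia.
rewrite card_in_imfset => [|i j _ _ eq_ij]; first by rewrite /= -cardE.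
by apply: ord_inj; have := ltn_ord i; have := ltn_ord j; lia.
Qed.

(** * From the chain polynomial to the h-polynomial *)

Lemma chain_polyE {d : Order.disp_t} (L : finPOrderType d) :
  chain_poly L = \sum_(C : {set L} | is_chain C) 'X^#|C|.
Proof.
apply/polyP=> k; rewrite coef_poly coef_sum.
rewrite (eq_bigr (fun C : {set L} => if k == #|C| then 1 else 0)); last first.
  by move=> C _; rewrite coefXn; case: eqP.
rewrite -big_mkcondr /= sumr_const.
case: ltnP => [_|lt_k].
  by congr _%:R; apply: eq_card => C; rewrite inE unfold_in (eq_sym k).
rewrite eq_card0 // => C; rewrite unfold_in; apply/negP=> /andP[_ /eqP eq_k].
by move: lt_k; rewrite eq_k ltnNge max_card.
Qed.

Lemma horner_chain_poly {d : Order.disp_t} (L : finPOrderType d) (y : Qx) :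
  (map_poly (fun c : rat => tofrac c%:P : Qx) (chain_poly L)).[y] =
  \sum_(C : {set L} | is_chain C) y ^+ #|C|.
Proof.
rewrite (eq_map_poly (g := (@tofrac _ \o polyC))) // chain_polyE rmorph_sum /= horner_sum.
by apply: eq_bigr => C _; rewrite map_polyXn hornerXn.
Qed.

Lemma varx_neq0 : varx != 0.
Proof. by rewrite tofrac_eq0 polyX_eq0. Qed.

Lemma one_sub_varx_neq0 : 1 - varx != 0.
Proof.
rewrite /varx -tofrac1 -tofracB tofrac_eq0 -opprB oppr_eq0.
by rewrite -polyC1 polyXsubC_eq0.
Qed.

(** Since 1 + y = 1/(1-x), the factor y^2 cancels and the powers of 1-x left over are m - |J|. *)
Lemma clear_denominators (F : fieldType) (x c : F) m (a : {set 'I_m} -> nat)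
    (y := x / (1 - x)) : x != 0 -> 1 - x != 0 ->
  y ^+ 2 * c = (1 + y) ^+ 2 * \sum_(J : {set 'I_m}) (a J)%:R * y ^+ #|J|.+2 ->
  (1 - x) ^+ m.+2 * c =
  \sum_(J : {set 'I_m}) (a J)%:R * (x ^+ #|J| * (1 - x) ^+ (m - #|J|)).
Proof.
move=> x0 x1 eq_c.
have y0 : y ^+ 2 != 0 by rewrite expf_neq0 // mulf_neq0 ?invr_eq0.
have y1 : 1 + y = (1 - x)^-1 by rewrite /y; field.
apply: (mulfI y0); rewrite mulrCA eq_c y1 !big_distrr /=; apply: eq_bigr => J _.
have le_J : (#|J| <= m)%N by rewrite -[leqRHS](card_ord m) max_card.
have {1}-> : m.+2 = (2 + #|J| + (m - #|J|))%N by lia.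
rewrite !exprD -[#|J|.+2]add2n exprD /y !exprMn !exprVn; field.
by rewrite expf_neq0 // x1.
Qed.

Lemma h_fracE n : (2 <= n)%N -> h_frac (setpart n) =
  \sum_(J : {set 'I_n.-1.-1}) (alpha (setpart n) (inner_ranks J))%:R *
    (varx ^+ #|J| * (1 - varx) ^+ (n.-1.-1 - #|J|)).
Proof.
move=> n2; have n0 : (0 < n)%N by apply: ltnW.
rewrite /h_frac horner_chain_poly.
rewrite (max_chain_sizeE (sp_rank_bot n) (sp_rank_top n0) (sp_rank_le n0)
   (sp_rank_cover n0)).
have -> : n.-1.+1 = n.-1.-1.+2 by case: n n2 {n0} => [|[]].
apply: (clear_denominators varx_neq0 one_sub_varx_neq0).
apply: (chain_sumE (sp_rank_bot n) (sp_rank_top n0) (sp_rank_le n0) (sp_rank_cover n0)).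
by case: n n2 {n0} => [|[]].
Qed.

Theorem proposition4p1 (n : nat) (hn : (2 <= n)%N) :
  (forall S : {fset nat}, {subset S <= iota 1 (n - 2)} ->
     beta (setpart n) S =
     (count (fun s => Des s == [fset (n - 1 - x)%N | x in S]%fset) (A n))%:Z)
  /\ h_frac (setpart n) = \sum_(s <- A n) varx ^+ des s.
Proof.
have n0 : (0 < n)%N by lia.
(* The cumulative count from which both claims follow. *)
have alphaS (S : {fset nat}) : alpha (setpart n) S =
    (\sum_(s <- A n) (coDes n s `<=` S)%fset)%N.
  rewrite alpha_setpart // -sum1_count big_mkcond !big_seq.
  by apply: eq_bigr => s sA; rewrite ok_coDes //; case: ifP.
split=> [S sS|].
  rewrite /beta.
  transitivity (\sum_(s <- A n) \sum_(T <- fpowerset S)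
      (-1) ^+ #|` (S `\` T)%fset| * (coDes n s `<=` T)%fset%:Z : int).
    rewrite exchange_big; apply: eq_bigr => T _.
    by rewrite alphaS -big_distrr /= -natz natr_sum; under [in RHS]eq_bigr do rewrite -natz.
  have -> (P : pred (seq nat)) : (count P (A n))%:Z = \sum_(s <- A n) (P s)%:Z.
    by elim: (A n) => [|s w IH]; rewrite ?big_nil // big_cons -IH /= PoszD.
  rewrite !big_seq; apply: eq_bigr => s sA.
  by rewrite fpowerset_moebius coDes_eq.
rewrite h_fracE //.
under eq_bigr do rewrite alphaS natr_sum big_distrl.
rewrite exchange_big !big_seq; apply: eq_bigr => s sA /=.
(* For a fixed word, J runs over the supersets of its reflected descent set. *)
rewrite -(card_coDes_ord sA) -superset_sum card_ord; apply: eq_bigr => J _.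
by rewrite coDes_ord_sub.
Qed.
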